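(* Let $\{x^k\}$ be generated by the coordinate descent algorithm described in the context. Suppose there exists $L>0$ such that, for every iteration $k$ and every trial point $z=z^{\mathrm{trial}}$ computed at iteration $k$, $$\|\nabla f_k(z)-\nabla M_k(z)\|\le L\|z-\bar x^k\|^p,\qquad M_k(\bar x^k)=f_k(\bar x^k),\qquad f_k(z)\le M_k(z)+L\|z-\bar x^k\|^{p+1}.$$ Let $f_{\mathrm{target}}\le f(x^0)$ and $\varepsilon>0$ be given. Then the number of iterations $k$ such that (i) $f(x^{k+1})>f_{\mathrm{target}}$ and (ii) $|[g_P(x^{k+1})]_i|>\varepsilon$ for some $i\in I_k$ is bounded by $$\frac{f(x^0)-f_{\mathrm{target}}}{c\,\varepsilon^{(p+1)/p}},$$ where $c>0$ only depends on $\alpha,\tau_2,L,p$ and $\theta$.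
   Context: $\|\cdot\|$ is the Euclidean norm. Let $\Omega=\{x\in\mathbb{R}^n:\ell\le x\le u\}$ with $\ell,u\in\mathbb{R}^n$, $\ell<u$ componentwise, and let $f$ have continuous first derivatives over $\Omega$. $P_C$ denotes Euclidean projection onto a closed convex set $C$; $g(x)=\nabla f(x)$ and $g_P(x)=P_\Omega(x-g(x))-x$. For $v\in\mathbb{R}^n$ and $I\subseteq\{1,\dots,n\}$, $v_I\in\mathbb{R}^{|I|}$ is the subvector of components with indices in $I$. Coordinate descent algorithm. Given: $p\in\{1,2,3,\dots\}$, $\alpha>0$, $\sigma_{\min}>0$, $\tau_2\ge\tau_1>1$, $\theta>0$, $x^0\in\Omega$. At each iteration $k=0,1,2,\dots$: choose a nonempty $I_k\subseteq\{1,\dots,n\}$. For $z\in\mathbb{R}^{|I_k|}$ let $x^k[z]$ be the vector with $(x^k[z])_{I_k}=z$ and $(x^k[z])_i=x^k_i$ for $i\notin I_k$. Put $f_k(z)=f(x^k[z])$, $\Omega_k=\{z\in\mathbb{R}^{|I_k|}:\ell_{I_k}\le z\le u_{I_k}\}$, $\bar x^k=x^k_{I_k}$, and let $M_k:\mathbb{R}^{|I_k|}\to\mathbb{R}$ be a model of $f_k$ around $\bar x^k$ whose gradient exists on $\Omega_k$. Step 1: set $\sigma\leftarrow 0$. Step 2: compute a trial point $z^{\mathrm{trial}}\in\Omega_k$ with $M_k(z^{\mathrm{trial}})+\sigma\|z^{\mathrm{trial}}-\bar x^k\|^{p+1}\le M_k(\bar x^k)$ and $$\Big\|P_{\Omega_k}\big[z^{\mathrm{trial}}-\nabla\big(M_k(z)+\sigma\|z-\bar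 x^k\|^{p+1}\big)\big|_{z=z^{\mathrm{trial}}}\big]-z^{\mathrm{trial}}\Big\|\le\theta\|z^{\mathrm{trial}}-\bar x^k\|^p.$$ Step 3: if $f_k(z^{\mathrm{trial}})\le f_k(\bar x^k)-\alpha\|z^{\mathrm{trial}}-\bar x^k\|^{p+1}$, accept it: set $x^{k+1}=x^k[z^{\mathrm{trial}}]$, $\sigma_k=\sigma$, and go to iteration $k+1$. Otherwise set $\sigma\leftarrow\max\{\sigma_{\min},\tau\sigma\}$ with some $\tau\in[\tau_1,\tau_2]$ and return to Step 2.
   Formalization: The constant c depends only on α, τ₂, L, p, θ when σ_min ≤ τ₂(L+α); for larger σ_min it may also depend on σ_min, since independence of σ_min fails (e.g. f(x) = −x on [0,1] with p = 1, α = 2, M_k = f_k and huge σ_min). *)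

(* Defs.v *)
From HB Require Import structures.
From mathcomp Require Import all_boot all_order all_algebra.
From mathcomp Require Import all_classical all_reals all_analysis.

Set Implicit Arguments.
Unset Strict Implicit.
Unset Printing Implicit Defensive.
Import Order.TTheory GRing.Theory Num.Theory.
Import numFieldNormedType.Exports.

Local Open Scope classical_set_scope.
Local Open Scope ring_scope.

Section CoordinateDescent.
Variable R : realType.

(* The library norm `|v| of a row vector is the sup norm. *)
Definition enorm (m : nat) (v : 'rV[R]_m) : R :=
  Num.sqrt (\sum_(i < m) v 0 i ^+ 2).

Definition box (m : nat) (l u : 'rV[R]_m) : set 'rV[R]_m :=
  [set y | forall i : 'I_m, l 0 i <= y 0 i <= u 0 i].

(* The minimizer is unique when C is nonempty, closed and convex; the default
   value 0 is returned only if no minimizer exists. *)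
Definition proj (m : nat) (C : set 'rV[R]_m) (y : 'rV[R]_m) : 'rV[R]_m :=
  xget 0 [set w | C w /\ forall w', C w' -> enorm (y - w) <= enorm (y - w')].

Definition has_grad (m : nat) (h : 'rV[R]_m -> R) (y : 'rV[R]_m) : Prop :=
  forall i : 'I_m, derivable h y (delta_mx 0 i).

Definition grad (m : nat) (h : 'rV[R]_m -> R) (y : 'rV[R]_m) : 'rV[R]_m :=
  \row_(i < m) 'D_(delta_mx 0 i) h y.

Definition C1_on (m : nat) (C : set 'rV[R]_m) (h : 'rV[R]_m -> R) : Prop :=
  (forall y, C y -> has_grad h y) /\ {within C, continuous (grad h)}.

Definition gP (n : nat) (l u : 'rV[R]_n) (f : 'rV[R]_n -> R) (x : 'rV[R]_n) :
    'rV[R]_n :=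
  proj (box l u) (x - grad f x) - x.

(* The j-th coordinate of R^|I| stands for the j-th element [enum_val j] of I,
   in increasing order. *)
Definition subvec (n : nat) (I : {set 'I_n}) (v : 'rV[R]_n) : 'rV[R]_#|I| :=
  \row_(j < #|I|) v 0 (enum_val j).

Definition replace (n : nat) (I : {set 'I_n}) (x : 'rV[R]_n)
    (z : 'rV[R]_#|I|) : 'rV[R]_n :=
  \row_(i < n)
    if [pick j : 'I_#|I| | enum_val j == i] is Some j then z 0 j else x 0 i.

Definition restr (n : nat) (I : {set 'I_n}) (f : 'rV[R]_n -> R)
    (x : 'rV[R]_n) (z : 'rV[R]_#|I|) : R :=
  f (replace x z).

Definition reg_model (m p : nat) (M : 'rV[R]_m -> R) (zbar : 'rV[R]_m)
    (sigma : R) (z : 'rV[R]_m) : R :=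
  M z + sigma * enorm (z - zbar) ^+ p.+1.

Definition trial_point (m p : nat) (theta : R) (C : set 'rV[R]_m)
    (M : 'rV[R]_m -> R) (zbar : 'rV[R]_m) (sigma : R) (z : 'rV[R]_m) : Prop :=
  [/\ C z,
      reg_model p M zbar sigma z <= M zbar &
      enorm (proj C (z - grad (reg_model p M zbar sigma) z) - z)
        <= theta * enorm (z - zbar) ^+ p].

Definition suff_decrease (m p : nat) (alpha : R) (fk : 'rV[R]_m -> R)
    (zbar z : 'rV[R]_m) : bool :=
  fk z <= fk zbar - alpha * enorm (z - zbar) ^+ p.+1.

(* Steps 1-3 at one iteration: [sigma j] and [z j], for [j <= J], are the
   successive regularization parameters and trial points. The trial points
   [z 0, ..., z J.-1] are rejected and [z J] is accepted; the values at
   indices larger than [J] play no role. *)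
Record inner_loop (m p : nat) (alpha sigma_min tau1 tau2 theta : R)
    (C : set 'rV[R]_m) (fk M : 'rV[R]_m -> R) (zbar : 'rV[R]_m)
    (J : nat) (sigma : nat -> R) (z : nat -> 'rV[R]_m) : Prop := InnerLoop {
  inner_start : sigma 0%N = 0;
  inner_trial : forall j, (j <= J)%N ->
    trial_point p theta C M zbar (sigma j) (z j);
  inner_reject : forall j, (j < J)%N -> ~~ suff_decrease p alpha fk zbar (z j);
  inner_update : forall j, (j < J)%N ->
    exists2 tau, tau1 <= tau <= tau2 &
      sigma j.+1 = Num.max sigma_min (tau * sigma j);
  inner_accept : suff_decrease p alpha fk zbar (z J) }.

(* A run of the algorithm. At iteration k, [I k] is the chosen block, [M k] the
   model, and [J k], [sigma k], [z k] describe the inner loop, as above. *)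
Record cd_run (n p : nat) (alpha sigma_min tau1 tau2 theta : R)
    (l u : 'rV[R]_n) (f : 'rV[R]_n -> R)
    (x : nat -> 'rV[R]_n) (I : nat -> {set 'I_n})
    (M : forall k, 'rV[R]_#|I k| -> R)
    (J : nat -> nat) (sigma : nat -> nat -> R)
    (z : forall k, nat -> 'rV[R]_#|I k|) : Prop := CDRun {
  cd_start : box l u (x 0%N);
  cd_block : forall k, I k != finset.set0;
  cd_model : forall k y, box (subvec (I k) l) (subvec (I k) u) y ->
    has_grad (M k) y;
  cd_inner : forall k,
    inner_loop p alpha sigma_min tau1 tau2 theta
      (box (subvec (I k) l) (subvec (I k) u)) (restr f (x k)) (M k)
      (subvec (I k) (x k)) (J k) (sigma k) (z k);
  cd_next : forall k, x k.+1 = replace (x k) (z k (J k)) }.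

Definition model_accuracy (m p : nat) (L : R) (fk M : 'rV[R]_m -> R)
    (zbar z : 'rV[R]_m) : Prop :=
  [/\ enorm (grad fk z - grad M z) <= L * enorm (z - zbar) ^+ p,
      M zbar = fk zbar &
      fk z <= M z + L * enorm (z - zbar) ^+ p.+1].

End CoordinateDescent.

(* Main.v *)
Require Import Defs.
From HB Require Import structures.
From mathcomp Require Import all_boot all_order all_algebra.
From mathcomp Require Import finmap lra ring.
From mathcomp Require Import all_classical all_reals all_analysis.

Set Implicit Arguments.
Unset Strict Implicit.
Unset Printing Implicit Defensive.
Import Order.TTheory GRing.Theory Num.Theory.
Import numFieldNormedType.Exports.

Local Open Scope classical_set_scope.
Local Open Scope ring_scope.

(* A rejected trial point has sigma < L + alpha, so every regularization
   parameter is at most S = max {sigma_min, tau2 (L + alpha)}. At the accepted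
   trial point, with step length d, the residual test on the regularized model
   and the gradient accuracy of the model give
     |g_P(x^{k+1})_i| <= (L + theta + S (p + 1)) d^p  for i in I_k,
   because projections onto boxes act coordinatewise and are nonexpansive.
   When the left-hand side exceeds eps, f decreases by at least
   alpha d^{p+1} >= alpha (eps / (L + theta + S (p + 1)))^{(p+1)/p}. *)

(** * Clipping to an interval, the one-dimensional projection *)

Section Clip.
Variable R : realType.

Lemma clip_itv (a b y : R) : a <= b -> a <= Num.max a (Num.min b y) <= b.
Proof. by move=> ab; rewrite le_max lexx/= ge_max ab ge_min lexx. Qed.

Lemma clip_lipschitz (a b y y' : R) :
  `|Num.max a (Num.min b y) - Num.max a (Num.min b y')| <= `|y - y'|.
Proof.
rewrite ler_norml; have := ler_norm (y - y'); have := ler_norm (y' - y).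
rewrite distrC => h1 h2; apply/andP.
by case: (leP b y) => ?; case: (leP b y') => ?; case: (leP a b) => ?;
  case: (leP a y) => ?; case: (leP a y') => ?; split; lra.
Qed.

(** Replacing [x - r] by [x - g] moves the clipped value by at most [|r - g|], which is split
    through [g']. In use, [g], [g'] and [r] are partial derivatives of the objective, the model and
    the regularized model. *)
Lemma clip_residual (a b x g r g' : R) :
  `|Num.max a (Num.min b (x - g)) - x| <=
  `|Num.max a (Num.min b (x - r)) - x| + `|g - g'| + `|r - g'|.
Proof.
have -> : x - g = x - r + (r - g) by lra.
apply: le_trans (ler_distD (Num.max a (Num.min b (x - r))) _ _) _.
rewrite [leLHS]addrC -[leRHS]addrA lerD2l; apply: le_trans (clip_lipschitz _ _ _ _) _.
have -> : x - r + (r - g) - (x - r) = (r - g') - (g - g') by lra.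
by rewrite addrC; exact: ler_normB.
Qed.

End Clip.

(** * Euclidean norm: derivatives of its powers and projection onto a box *)

Section Enorm.
Variables (R : realType) (m : nat).
Implicit Types v : 'rV[R]_m.

Lemma enorm_ge0 v : 0 <= enorm v.
Proof. exact: sqrtr_ge0. Qed.

Lemma sqr_enorm v : enorm v ^+ 2 = \sum_(i < m) v 0 i ^+ 2.
Proof. by rewrite sqr_sqrtr// sumr_ge0// => i _; exact: sqr_ge0. Qed.

Lemma coord_le_enorm v i : `|v 0 i| <= enorm v.
Proof.
rewrite -(@ler_pXn2r _ 2)// ?nnegrE ?enorm_ge0//.
rewrite sqr_enorm (bigD1 i)//= real_normK ?num_real// lerDl.
by rewrite sumr_ge0// => j _; exact: sqr_ge0.
Qed.

Lemma is_derive_line (W : normedModType R) (F : 'rV[R]_m -> W) v w df :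
  is_derive (0 : R) 1 (fun h : R => F (h *: v + w)) df -> is_derive w v F df.
Proof.
pose G (h : R) := F (h *: v + w).
have E : (fun h : R => h^-1 *: ((G \o shift 0) (h *: 1) - G 0)) =
    (fun h => h^-1 *: ((F \o shift w) (h *: v) - F w)).
  by apply/funext => h; rewrite /G/= scale0r add0r addr0 [h *: 1]mulr1.
by case; rewrite /derivable /derive E.
Qed.

(** The difference quotient at 0 has absolute value [|h| ^+ p], which tends to 0. *)
Lemma is_derive_normX (p : nat) : (0 < p)%N ->
  is_derive (0 : R) 1 (fun h : R => `|h| ^+ p.+1) (0 : R).
Proof.
move=> p0.
pose N (h : R) : R := `|h| ^+ p.+1.
pose q (h : R) : R := h^-1 *: ((N \o shift 0) (h *: 1) - N 0).
have H : q h @[h --> 0^'] --> (0 : R).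
  apply/norm_cvg0P.
  have -> : (fun h : R => `|q h|) = (fun h : R => `|h| ^+ p).
    apply/funext => h; rewrite /q /N /= [h *: 1]mulr1 addr0 normr0 expr0n subr0.
    (* At [h = 0] the inverse is 0 by convention, and [0 ^+ p = 0] because [p > 0]. *)
    have [->|h0] := eqVneq h 0.
      by rewrite normr0 !expr0n/= eqn0Ngt p0 [_ *: _]mulr0 normr0.
    rewrite [_ *: _]/(_ * _) normrM normfV normrX normr_id exprS mulrA.
    by rewrite mulVf ?normr_eq0// mul1r.
  apply: cvg_within_filter.
  have : continuous (fun h : R => `|h| ^+ p).
    move=> h.
    apply: (@continuous_comp _ _ _ (fun h : R => `|h|) (fun h => h ^+ p)).
      exact: norm_continuous.
    exact: exprn_continuous.
  by move=> /(_ 0); rewrite /continuous_at normr0 expr0n eqn0Ngt p0.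
by split; [exact: cvgP H | exact: cvg_lim H].
Qed.

Lemma enorm_line v j (h : R) :
  enorm (h *: delta_mx 0 j + v) ^+ 2 = h ^+ 2 + h * v 0 j *+ 2 + enorm v ^+ 2.
Proof.
rewrite !sqr_enorm (bigD1 j)//= [in RHS](bigD1 j)//= !mxE !eqxx/=.
under eq_bigr => i ij do rewrite !mxE (negbTE ij) andbF mulr0 add0r.
by rewrite mulr1 sqrrD !addrA.
Qed.

Lemma enorm_eq0 v : enorm v = 0 -> v = 0.
Proof.
move=> v0; apply/rowP => i; rewrite mxE; apply/normr0_eq0/le_anti.
by rewrite normr_ge0 -v0 coord_le_enorm.
Qed.

(** Along a coordinate line the squared norm is quadratic, so the chain rule through [Num.sqrt]
    applies when [w] differs from [c]. At [w = c] the root is not differentiable, but there the norm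
    is just [|h|]. *)
Lemma is_derive_enormX (p : nat) (c w : 'rV[R]_m) (j : 'I_m) : (0 < p)%N ->
  is_derive w (delta_mx 0 j) (fun y => enorm (y - c) ^+ p.+1)
    (p.+1%:R * enorm (w - c) ^+ p.-1 * (w - c) 0 j).
Proof.
move=> p0; apply: is_derive_line.
under eq_fun => h do rewrite -addrA.
move: (w - c) => v.
have enormE h : enorm (h *: delta_mx 0 j + v) =
    Num.sqrt (h ^+ 2 + h * v 0 j *+ 2 + enorm v ^+ 2).
  by rewrite -enorm_line sqrtr_sqr ger0_norm// enorm_ge0.
have [/enorm_eq0 v0|vn0] := eqVneq (enorm v) 0.
  have -> : (fun h : R => enorm (h *: delta_mx 0 j + v) ^+ p.+1) =
      (fun h => `|h| ^+ p.+1).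
    apply/funext => h; congr (_ ^+ _).
    rewrite enormE v0 mxE mulr0 mul0rn addr0.
    have -> : enorm (0 : 'rV[R]_m) = 0.
      by rewrite /enorm big1 ?sqrtr0// => i _; rewrite mxE expr0n.
    by rewrite expr0n addr0 sqrtr_sqr.
  by rewrite v0 mxE mulr0; exact: is_derive_normX.
have v0 : 0 < enorm v by rewrite lt_neqAle eq_sym vn0 enorm_ge0.
under eq_fun => h do rewrite enormE.
pose q := fun h : R => h ^+ 2 + h * v 0 j *+ 2 + enorm v ^+ 2.
have q0 : q 0 = enorm v ^+ 2 by rewrite /q expr0n mul0r mul0rn !add0r.
have dq : is_derive (0 : R) 1 q (v 0 j *+ 2).
  have -> : q = (id ^+ 2 + (v 0 j *+ 2) \*: id + cst (enorm v ^+ 2)).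
    by apply/funext => h; rewrite /q/= !fctE -mulrnAr mulrC.
  apply: is_derive_eq.
  by rewrite /= ![_ *: 1]mulr1; ring.
have ds : is_derive (q 0) 1 Num.sqrt (2 * enorm v)^-1.
  have := @is_derive1_sqrt R (q 0); rewrite q0 sqrtr_sqr ger0_norm ?enorm_ge0//.
  by apply; rewrite exprn_gt0.
have dc := is_derive1_comp ds dq.
rewrite (_ : (fun h => _) = (Num.sqrt \o q) ^+ p.+1); last first.
  by apply/funext => h; rewrite exprfctE.
apply: (is_derive_eq (is_deriveX p.+1 dc)) => /=.
rewrite q0 sqrtr_sqr ger0_norm ?enorm_ge0//.
change (p.+1%:R * enorm v ^+ p * ((2 * enorm v)^-1 * (v 0 j *+ 2)) =
  p.+1%:R * enorm v ^+ p.-1 * v 0 j).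
have -> : enorm v ^+ p = enorm v ^+ p.-1 * enorm v by rewrite -exprSr prednK.
by field; rewrite vn0.
Qed.

(* [proj] alone now denotes a projection of MathComp-Analysis. *)
Lemma proj_box (a b y : 'rV[R]_m) (i : 'I_m) : (forall i, a 0 i <= b 0 i) ->
  Defs.proj (box a b) y 0 i = Num.max (a 0 i) (Num.min (b 0 i) (y 0 i)).
Proof.
move=> ab.
pose w0 : 'rV[R]_m := \row_i Num.max (a 0 i) (Num.min (b 0 i) (y 0 i)).
(* Obtuse-angle inequality, checked coordinate by coordinate; it yields both the minimality and the
   uniqueness of [w0]. *)
have gap (w : 'rV[R]_m) : box a b w ->
    enorm (y - w0) ^+ 2 + enorm (w - w0) ^+ 2 <= enorm (y - w) ^+ 2.
  move=> bw; rewrite !sqr_enorm -big_split/=; apply: ler_sum => k _.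
  rewrite !mxE; have /andP[aw wb] := bw k; have abk := ab k.
  case: (leP (b 0 k) (y 0 k)) => ?; first by rewrite (max_r abk); nra.
  by case: (leP (a 0 k) (y 0 k)) => ?; nra.
suff -> : Defs.proj (box a b) y = w0 by rewrite mxE.
apply: xget_unique.
- split=> [k|w' bw']; first by rewrite mxE clip_itv.
  rewrite -(@ler_pXn2r _ 2)// ?nnegrE ?enorm_ge0//.
  by apply: le_trans (gap _ bw'); rewrite lerDl sqr_ge0.
- move=> w [bw wmin]; apply/eqP; rewrite -subr_eq0; apply/eqP/enorm_eq0.
  have bw0 : box a b w0 by move=> k; rewrite mxE clip_itv.
  have := wmin _ bw0; rewrite -(@ler_pXn2r _ 2)// ?nnegrE ?enorm_ge0// => le1.
  have := le_trans (gap _ bw) le1; rewrite gerDl => le2.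
  by apply/eqP; rewrite -sqrf_eq0; apply/eqP/le_anti; rewrite le2 sqr_ge0.
Qed.

End Enorm.

(** * Counting the large decreases of a monotone sequence *)

Lemma decrease_count (R : realType) (a : nat -> R) (K : set nat) (d t : R) :
  (forall k, a k.+1 <= a k) -> (forall k, K k -> a k.+1 <= a k - d) ->
  (forall k, K k -> t <= a k.+1) -> t <= a 0%N -> 0 < d ->
  finite_set K /\ (#|` fset_set K|)%:R <= (a 0%N - t) / d.
Proof.
move=> amono adecr Kt at0 d0.
pose N m := size [seq k <- iota 0 m | `[< K k >]].
have NS m : N m.+1 = (N m + `[< K m >])%N.
  by rewrite /N -addn1 iotaD filter_cat size_cat add0n /=; case: ifP.
have aN m : a m <= a 0%N - (N m)%:R * d.
  elim: m => [|m IH]; first by rewrite mul0r subr0.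
  rewrite NS; case: asboolP => [Km|_] /=; last first.
    by rewrite addn0 (le_trans (amono m)).
  rewrite natrD mulrDl mul1r opprD addrA.
  by apply: le_trans (adecr m Km) _; rewrite lerD2r.
(* After the start, [t] is known to bound [a] from below only right after an index of [K]. The count
   grows only there; elsewhere the bound is inherited. *)
have Nle m : (N m)%:R * d <= a 0%N - t.
  elim: m => [|m IH]; first by rewrite mul0r subr_ge0.
  have := aN m.+1; rewrite NS; case: asboolP => [Km|_] /=; last by rewrite addn0.
  by move=> aS; have := Kt m Km; lra.
have Ble (B : {fset nat}) : [set` B] `<=` K -> (#|` B|)%:R * d <= a 0%N - t.
  move=> BK; pose m := (\max_(k <- B) k).+1.
  apply: le_trans (Nle m); rewrite ler_pM2r// ler_nat.
  apply: uniq_leq_size => [|k kB]; first exact: fset_uniq.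
  rewrite mem_filter; apply/andP; split; first exact/asboolP/BK.
  by rewrite mem_iota add0n ltnS (@leq_bigmax_seq _ (enum_fset B) xpredT id).
(* An infinite [K] would have a finite subset with more than [(a 0 - t) / d] elements, against
   [Ble]. *)
have finK : finite_set K.
  apply: contrapT => infK.
  have [B BK] := infinite_set_fset (Num.truncn ((a 0%N - t) / d)).+1 infK.
  apply/negP; rewrite -ltnNge ltnS truncn_ge_nat.
    by rewrite ler_pdivlMr// Ble.
  by rewrite divr_ge0 ?subr_ge0 ?(ltW d0).
split => //; rewrite ler_pdivlMr// Ble// fset_setK//.
Qed.

(** * One iteration: residual and regularization bounds *)

Section Iteration.
Variables (R : realType) (m p : nat) (alpha theta L : R).
Variables (a b : 'rV[R]_m) (h M : 'rV[R]_m -> R) (zbar : 'rV[R]_m).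
Hypotheses (p_gt0 : (0 < p)%N) (ab : forall i, a 0 i <= b 0 i).

Lemma grad_reg_model s z i : has_grad M z ->
  grad (reg_model p M zbar s) z 0 i =
  grad M z 0 i + s * (p.+1%:R * enorm (z - zbar) ^+ p.-1 * (z - zbar) 0 i).
Proof.
move=> Mz; rewrite !mxE.
have dE := is_derive_enormX zbar z i p_gt0.
have dM : is_derive z (delta_mx 0 i) M ('D_(delta_mx 0 i) M z).
  by split => //; exact: Mz.
have := is_deriveD dM (is_deriveZ s dE) => /@derive_val.
by rewrite !mxE.
Qed.

Lemma trial_residual_le s S z i : has_grad M z -> 0 <= s <= S ->
  trial_point p theta (box a b) M zbar s z ->
  model_accuracy p L h M zbar z ->
  `|Defs.proj (box a b) (z - grad h z) 0 i - z 0 i|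
    <= (L + theta + S * p.+1%:R) * enorm (z - zbar) ^+ p.
Proof.
move=> Mz /andP[s0 sS] [_ _ tz] [accz _ _].
set d := enorm (z - zbar) in tz accz *.
have d0 : 0 <= d by exact: enorm_ge0.
set r := grad (reg_model p M zbar s) z in tz.
(* The gradient of the regularization carries [d ^+ p.-1]; the coordinate of [z - zbar], at most
   [d], supplies the missing factor. *)
have reg_le : `|r 0 i - grad M z 0 i| <= S * p.+1%:R * d ^+ p.
  rewrite /r grad_reg_model// addrAC subrr add0r !normrM (ger0_norm s0).
  rewrite normr_nat (ger0_norm (exprn_ge0 _ d0)) -2!mulrA.
  apply: ler_pM => //; first by rewrite !mulr_ge0 ?exprn_ge0.
  rewrite ler_wpM2l// -[in leRHS](prednK p_gt0) exprSr ler_wpM2l ?exprn_ge0//.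
  exact: coord_le_enorm.
have acc_le : `|grad h z 0 i - grad M z 0 i| <= L * d ^+ p.
  apply: le_trans accz.
  by have := coord_le_enorm (grad h z - grad M z) i; rewrite !mxE.
have trial_le : `|Defs.proj (box a b) (z - r) 0 i - z 0 i| <= theta * d ^+ p.
  apply: le_trans tz.
  by have := coord_le_enorm (Defs.proj (box a b) (z - r) - z) i; rewrite 2!mxE.
rewrite (proj_box (z - r) i ab) in trial_le.
rewrite (proj_box (z - grad h z) i ab).
move: acc_le reg_le trial_le; clear tz; move: (grad h z) (grad M z) r => g gM r.
rewrite !mxE => acc_le reg_le trial_le.
apply: le_trans (clip_residual _ _ _ (g 0 i) (r 0 i) (gM 0 i)) _.
rewrite 2!mulrDl [L * _ + _]addrC.
by apply: lerD; [exact: lerD|].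
Qed.

(** The value of [h] at [z] exceeds [M z] by at most [L * d ^+ p.+1], with [d] the step length,
    while [M z] is below [M zbar] by at least [s * d ^+ p.+1]; and [s - L >= alpha]. *)
Lemma large_sigma_accepted s z :
  L + alpha <= s -> reg_model p M zbar s z <= M zbar ->
  model_accuracy p L h M zbar z -> suff_decrease p alpha h zbar z.
Proof.
move=> ls; rewrite /reg_model /suff_decrease => dec [_ <- le_h].
have : (L + alpha) * enorm (z - zbar) ^+ p.+1 <= s * enorm (z - zbar) ^+ p.+1.
  by rewrite ler_wpM2r// exprn_ge0// enorm_ge0.
rewrite mulrDl; lra.
Qed.

Lemma sigma_bound sigma_min tau1 tau2 J sigma z :
  0 < L + alpha -> 0 < sigma_min -> 1 < tau1 ->
  inner_loop p alpha sigma_min tau1 tau2 theta (box a b) h M zbar J sigma z ->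
  (forall j, (j <= J)%N -> model_accuracy p L h M zbar (z j)) ->
  forall j, (j <= J)%N ->
    0 <= sigma j <= Num.max sigma_min (tau2 * (L + alpha)).
Proof.
move=> La0 smin0 tau11 loop acc [|j] jJ.
  by rewrite (inner_start loop) lexx le_max ltW.
have [tau /andP[t1 t2] ->] := inner_update loop jJ.
have sj : sigma j < L + alpha.
  rewrite ltNge; apply/negP => ls; have /negP := inner_reject loop jJ; apply.
  have [_ dec _] := inner_trial loop (ltnW jJ).
  exact: large_sigma_accepted ls dec (acc _ (ltnW jJ)).
have tau0 : 0 <= tau by lra.
rewrite le_max (ltW smin0)/= ge_max !le_max lexx/=; apply/orP; right.
apply: (@le_trans _ _ (tau * (L + alpha))); first by rewrite ler_wpM2l// ltW.
by rewrite ler_pM2r.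
Qed.

End Iteration.

(** * Transfer between a coordinate block and the full space *)

Section Replace.
Variables (R : realType) (n : nat) (I : {set 'I_n}).
Implicit Types (x : 'rV[R]_n) (z : 'rV[R]_#|I|).

Lemma replace_in x z j : replace x z 0 (enum_val j) = z 0 j.
Proof.
rewrite mxE; case: pickP => [j' /eqP /enum_val_inj -> //|/(_ j)].
by rewrite eqxx.
Qed.

Lemma replace_out x z i : i \notin I -> replace x z 0 i = x 0 i.
Proof.
move=> iI; rewrite mxE; case: pickP => // j /eqP ji.
by rewrite -ji enum_valP in iI.
Qed.

Lemma replaceP x z (P : 'I_n -> R -> Prop) :
  (forall j, P (enum_val j) (z 0 j)) ->
  (forall i, i \notin I -> P i (x 0 i)) -> forall i, P i (replace x z 0 i).
Proof.
move=> Pz Px i; have [iI|iI] := boolP (i \in I); last first.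
  by rewrite replace_out//; exact: Px.
by rewrite -(enum_rankK_in iI iI) replace_in.
Qed.

Lemma replace_subvec x : replace x (subvec I x) = x.
Proof.
apply/rowP; apply: (replaceP (P := fun i r => r = x 0 i)) => // j.
by rewrite mxE.
Qed.

(** Moving [z] along its [j]-th axis moves [replace x z] along axis [enum_val j], so the two
    difference quotients coincide. *)
Lemma grad_restr (f : 'rV[R]_n -> R) x z j :
  grad (restr f x) z 0 j = grad f (replace x z) 0 (enum_val j).
Proof.
have E (h : R) : restr f x (h *: delta_mx 0 j + z) =
    f (h *: delta_mx 0 (enum_val j) + replace x z).
  congr f; apply/rowP.
  apply: (replaceP (P := fun i r =>
    r = (h *: delta_mx 0 (enum_val j) + replace x z) 0 i)) => [k|i iI].
    rewrite [RHS]mxE replace_in !mxE.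
    by rewrite (inj_eq enum_val_inj).
  rewrite [RHS]mxE replace_out// !mxE.
  rewrite (_ : (i == enum_val j) = false) ?andbF ?mulr0 ?add0r//.
  by apply/negbTE; apply: contraNneq iI => ->; exact: enum_valP.
rewrite !mxE /derive.
by under eq_fun => h do rewrite /= E.
Qed.

Lemma gP_replace (l u : 'rV[R]_n) (f : 'rV[R]_n -> R) x z j : (forall i, l 0 i <= u 0 i) ->
  gP l u f (replace x z) 0 (enum_val j) =
  Defs.proj (box (subvec I l) (subvec I u)) (z - grad (restr f x) z) 0 j - z 0 j.
Proof.
move=> lu; have lu' i : subvec I l 0 i <= subvec I u 0 i by rewrite !mxE.
rewrite /gP [LHS]mxE (proj_box _ _ lu).
rewrite (proj_box _ _ lu').
have := replace_in x z j; have := grad_restr f x z j.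
move: (replace x z) => y; rewrite !mxE => gE yE.
by rewrite gE yE.
Qed.

End Replace.

(* The constant is c (max {sigma_min, tau2 (L + alpha)}): it depends only on
   alpha, tau2, L, p and theta as long as sigma_min <= tau2 (L + alpha). Some
   dependence on larger values of sigma_min cannot be avoided: as soon as
   sigma = 0 is rejected, a huge sigma_min forces very short steps. *)
Theorem theorem5p1 (R : realType) (p : nat) (alpha tau2 L theta : R)
    (p_gt0 : (0 < p)%N) (alpha_gt0 : 0 < alpha) (tau2_gt1 : 1 < tau2)
    (L_gt0 : 0 < L) (theta_gt0 : 0 < theta) :
  exists c : R -> R, (forall s, 0 < s -> 0 < c s) /\
  forall (n : nat) (l u : 'rV[R]_n) (f : 'rV[R]_n -> R)
    (sigma_min tau1 : R)
    (x : nat -> 'rV[R]_n) (I : nat -> {set 'I_n})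
    (M : forall k, 'rV[R]_#|I k| -> R)
    (J : nat -> nat) (sigma : nat -> nat -> R)
    (z : forall k, nat -> 'rV[R]_#|I k|)
    (f_target eps : R),
  (forall i, l 0 i < u 0 i) ->
  C1_on (box l u) f ->
  0 < sigma_min ->
  1 < tau1 <= tau2 ->
  cd_run p alpha sigma_min tau1 tau2 theta l u f x M J sigma z ->
  (forall k j, (j <= J k)%N ->
    model_accuracy p L (restr f (x k)) (M k) (subvec (I k) (x k)) (z k j)) ->
  f_target <= f (x 0%N) ->
  0 < eps ->
  let K := [set k : nat | f (x k.+1) > f_target /\
    exists2 i : 'I_n, i \in I k & `|gP l u f (x k.+1) 0 i| > eps] in
  finite_set K /\
  (#|` fset_set K|)%:R <=
    (f (x 0%N) - f_target) /
      (c (Num.max sigma_min (tau2 * (L + alpha))) *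
        eps `^ (p.+1%:R / p%:R)).

Proof.
pose C s := L + theta + s * p.+1%:R.
pose e : R := p.+1%:R / p%:R.
have C_gt0 s : 0 < s -> 0 < C s by move=> s0; rewrite !addr_gt0// mulr_gt0.
(* In the extreme case [C s * d ^+ p = eps], the guaranteed decrease [alpha * d ^+ p.+1] is this
   constant times [eps] to the power [e]. *)
exists (fun s => alpha / C s `^ e); split=> [s s0|].
  by rewrite divr_gt0// powR_gt0// C_gt0.
move=> n l u f smin tau1 x I M J sigma z ft eps lu _ smin0 /andP[tau11 _].
move=> run acc ftx0 eps0 K.
set S := Num.max _ _.
have S0 : 0 < S by rewrite lt_max smin0.
have lu' k i : subvec (I k) l 0 i <= subvec (I k) u 0 i by rewrite !mxE ltW.
have fz k : f (x k.+1) <=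
    f (x k) - alpha * enorm (z k (J k) - subvec (I k) (x k)) ^+ p.+1.
  have := inner_accept (cd_inner run k).
  by rewrite /suff_decrease /restr replace_subvec -(cd_next run).
apply: (decrease_count (a := fun k => f (x k))) => //.
- move=> k; apply: le_trans (fz k) _.
  by rewrite gerBl mulr_ge0 ?exprn_ge0 ?enorm_ge0// ltW.
- move=> k [_ [i iI]]; rewrite (cd_next run) => gPi.
  set d := enorm (z k (J k) - subvec (I k) (x k)).
  have [bz _ _] := inner_trial (cd_inner run k) (leqnn (J k)).
  have sb := sigma_bound (addr_gt0 L_gt0 alpha_gt0) smin0 tau11
    (cd_inner run k) (acc k) (leqnn (J k)).
  have := trial_residual_le p_gt0 (lu' k) (enum_rank_in iI i) (cd_model run bz) sb
    (inner_trial (cd_inner run k) (leqnn (J k))) (acc k _ (leqnn (J k))).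
  rewrite -gP_replace; last by move=> ?; exact: ltW.
  rewrite enum_rankK_in// => gPle.
  have epsd : eps <= C S * d ^+ p by exact: ltW (lt_le_trans gPi gPle).
  rewrite -(cd_next run); apply: le_trans (fz k) _; rewrite lerD2l lerN2.
  have d0 : 0 <= d by exact: enorm_ge0.
  have e0 : 0 <= e by rewrite divr_ge0.
  (* In this form the decrease follows from [epsd] by raising both sides to the real power [e]. *)
  have -> : d ^+ p.+1 = (d ^+ p) `^ e.
    rewrite -powR_mulrn// -powR_mulrn// -powRrM /e mulrCA divff ?mulr1//.
    by rewrite pnatr_eq0 -lt0n.
  rewrite -mulrA ler_wpM2l ?(ltW alpha_gt0)//.
  rewrite ler_pdivrMl ?powR_gt0 ?C_gt0//.
  rewrite -powRM ?exprn_ge0 ?(ltW (C_gt0 _ S0))//.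
  apply: ge0_ler_powR => //; rewrite nnegrE; first exact: ltW.
  by rewrite mulr_ge0 ?exprn_ge0 ?(ltW (C_gt0 _ S0)).
- by move=> k [/ltW].
- by rewrite mulr_gt0 ?divr_gt0 ?powR_gt0 ?C_gt0.
Qed.
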